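(* The group \[G=\langle a,b,t \mid tat^{-1}=ab,\ tbt^{-1}=b\rangle\] acts properly, preserving factors, on a product of three trees, but does not act properly, preserving factors, on any product of two trees.
   Context: Trees are simplicial trees, not necessarily locally finite. A group $G$ acts on a product of trees $P=T_1\times\cdots\times T_n$ preserving factors if the action is given by a homomorphism $G\to\mathrm{Aut}(T_1)\times\cdots\times\mathrm{Aut}(T_n)$. The action is proper if the stabiliser of every vertex of $P$ is finite. *)

(* Defs.v *)
From HB Require Import structures.
From mathcomp Require Import all_boot.
From mathcomp Require Import all_classical.

Set Implicit Arguments.
Unset Strict Implicit.
Unset Printing Implicit Defensive.

Local Open Scope classical_set_scope.
Local Open Scope quotient_scope.
Local Open Scope group_scope.

(* The letter (x, false) stands for the generator x and (x, true) for x^-1. *)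
Definition word (X : Type) := seq (X * bool).

Definition word_inv (X : Type) (w : word X) : word X :=
  rev [seq (l.1, ~~ l.2) | l <- w].

(* Equality of words in the group <X | l = r for (l, r) in R>. *)
Inductive pres_eq (X : Type) (R : set (word X * word X)) :
    word X -> word X -> Prop :=
| pres_refl u : pres_eq R u u
| pres_sym u v : pres_eq R u v -> pres_eq R v u
| pres_trans v u w : pres_eq R u v -> pres_eq R v w -> pres_eq R u w
| pres_cancel u x e v : pres_eq R (u ++ [:: (x, e); (x, ~~ e)] ++ v) (u ++ v)
| pres_rel u l r v : R (l, r) -> pres_eq R (u ++ l ++ v) (u ++ r ++ v).

Section Presentation.
Variables (X : choiceType) (R : set (word X * word X)).

Lemma pres_catl u v w : pres_eq R v w -> pres_eq R (u ++ v) (u ++ w).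
Proof.
elim=> {v w} [v|v w _|w v z _ + _|a x e b|a l r b Rlr].
- exact: pres_refl.
- exact: pres_sym.
- exact: pres_trans.
- by have := pres_cancel R (u ++ a) x e b; rewrite -!catA.
- by have := pres_rel (u ++ a) b Rlr; rewrite -!catA.
Qed.

Lemma pres_catr u v w : pres_eq R v w -> pres_eq R (v ++ u) (w ++ u).
Proof.
elim=> {v w} [v|v w _|w v z _ + _|a x e b|a l r b Rlr].
- exact: pres_refl.
- exact: pres_sym.
- exact: pres_trans.
- by have := pres_cancel R a x e (b ++ u); rewrite -!catA.
- by have := pres_rel a (b ++ u) Rlr; rewrite -!catA.
Qed.

Lemma pres_cat u u' v v' :
  pres_eq R u u' -> pres_eq R v v' -> pres_eq R (u ++ v) (u' ++ v').
Proof. by move=> /pres_catr uu' /pres_catl vv'; apply: pres_trans (vv' _). Qed.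

Lemma word_invK : involutive (@word_inv X).
Proof.
move=> w; rewrite /word_inv map_rev revK -map_comp -[RHS]map_id.
by apply: eq_map => -[x e] /=; rewrite negbK.
Qed.

Lemma pres_mulwV u : pres_eq R (u ++ word_inv u) [::].
Proof.
elim: u => [|[x e] u IH]; first exact: pres_refl.
rewrite /word_inv /= rev_cons -cats1 catA.
apply: pres_trans (pres_cancel R [::] x e [::]).
exact: (pres_catl [:: (x, e)] (pres_catr [:: (x, ~~ e)] IH)).
Qed.

Lemma pres_mulVw u : pres_eq R (word_inv u ++ u) [::].
Proof. by have := pres_mulwV (word_inv u); rewrite word_invK. Qed.

Lemma pres_inv u v : pres_eq R u v -> pres_eq R (word_inv u) (word_inv v).
Proof.
move=> uv.
have h1 := pres_catl (word_inv u) (pres_sym (pres_mulwV v)).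
have h2 := pres_catl (word_inv u) (pres_catr (word_inv v) (pres_sym uv)).
have h3 := pres_catr (word_inv v) (pres_mulVw u).
rewrite cats0 in h1; rewrite -catA in h3.
exact: pres_trans h1 (pres_trans h2 h3).
Qed.

Definition pres_eqb (u v : word X) : bool := `[< pres_eq R u v >].

Lemma pres_eqb_refl : reflexive pres_eqb.
Proof. by move=> u; apply/asboolP; exact: pres_refl. Qed.

Lemma pres_eqb_sym : symmetric pres_eqb.
Proof. by move=> u v; apply/idP/idP => /asboolP/pres_sym/asboolP. Qed.

Lemma pres_eqb_trans : transitive pres_eqb.
Proof. by move=> v u w /asboolP uv /asboolP/(pres_trans uv)/asboolP. Qed.

Canonical pres_equiv :=
  EquivRel pres_eqb pres_eqb_refl pres_eqb_sym pres_eqb_trans.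

Definition presented := {eq_quot pres_equiv}.

HB.instance Definition _ := Choice.on presented.
HB.instance Definition _ : EqQuotient _ pres_eqb presented :=
  EqQuotient.on presented.

Definition pres_mk (w : word X) : presented := \pi_presented w.

Lemma pres_mkP u v : pres_mk u = pres_mk v <-> pres_eq R u v.
Proof.
by split=> [/eqmodP/asboolP|uv]; last by apply/eqmodP/asboolP.
Qed.

Lemma pres_reprK (g : presented) : pres_mk (repr g) = g.
Proof. exact: reprK. Qed.

Lemma repr_pres_mk u : pres_eq R (repr (pres_mk u)) u.
Proof. by apply/pres_mkP; rewrite pres_reprK. Qed.

Definition pres_one : presented := pres_mk [::].
Definition pres_mul (g h : presented) : presented :=
  pres_mk (repr g ++ repr h).
Definition pres_invg (g : presented) : presented :=
  pres_mk (word_inv (repr g)).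

Lemma pres_mulE u v : pres_mul (pres_mk u) (pres_mk v) = pres_mk (u ++ v).
Proof. by apply/pres_mkP/pres_cat; exact: repr_pres_mk. Qed.

Lemma pres_invE u : pres_invg (pres_mk u) = pres_mk (word_inv u).
Proof. by apply/pres_mkP/pres_inv; exact: repr_pres_mk. Qed.

Lemma pres_mulA : associative pres_mul.
Proof.
by move=> g h k; rewrite -(pres_reprK g) -(pres_reprK h) -(pres_reprK k)
  !pres_mulE catA.
Qed.

Lemma pres_mul1 : left_id pres_one pres_mul.
Proof. by move=> g; rewrite -(pres_reprK g) pres_mulE. Qed.

Lemma pres_mulr1 : right_id pres_one pres_mul.
Proof. by move=> g; rewrite -(pres_reprK g) pres_mulE cats0. Qed.

Lemma pres_mulV : left_inverse pres_one pres_invg pres_mul.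
Proof.
move=> g; rewrite -(pres_reprK g) pres_invE pres_mulE.
by apply/pres_mkP; exact: pres_mulVw.
Qed.

Lemma pres_mulrV : right_inverse pres_one pres_invg pres_mul.
Proof.
move=> g; rewrite -(pres_reprK g) pres_invE pres_mulE.
by apply/pres_mkP; exact: pres_mulwV.
Qed.

HB.instance Definition _ := isGroup.Build presented
  pres_mulA pres_mul1 pres_mulr1 pres_mulV pres_mulrV.

End Presentation.

Record tree := Tree {
  vertex :> eqType;
  adj : rel vertex;
  adj_sym : symmetric adj;
  adj_irr : irreflexive adj;
  tree_inh : inhabited vertex;
  tree_conn : forall x y, exists2 p, path adj x p & y = last x p;
  tree_acyclic : forall c : seq vertex, 2 < size c -> ~ ucycle adj c
}.

(* Automorphisms may invert edges. *)
Record tree_aut (T : tree) := TreeAut {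
  aut_fun :> T -> T;
  aut_inv : T -> T;
  aut_funK : cancel aut_fun aut_inv;
  aut_invK : cancel aut_inv aut_fun;
  aut_adj : {mono aut_fun : x y / adj x y}
}.

Section TreeAut.
Variable T : tree.

Lemma tree_aut_ext (f g : tree_aut T) : f =1 g -> f = g.
Proof.
case: f g => [f f' fK f'K fa] [g g' gK g'K ga] /= fg.
have {}fg : f = g by apply/funext.
subst g; have f'g' : f' = g' by apply/funext => x; rewrite -{1}[x]g'K fK.
by subst g'; congr TreeAut; exact: Prop_irrelevance.
Qed.

HB.instance Definition _ := gen_eqMixin (tree_aut T).
HB.instance Definition _ := gen_choiceMixin (tree_aut T).

Definition aut_one : tree_aut T.
Proof. by exists id id. Defined.

Definition aut_mul (f g : tree_aut T) : tree_aut T.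
Proof.
exists (f \o g) (aut_inv g \o aut_inv f).
- exact: can_comp (@aut_funK _ f) (@aut_funK _ g).
- exact: can_comp (@aut_invK _ g) (@aut_invK _ f).
- by move=> x y /=; rewrite !aut_adj.
Defined.

Definition aut_invg (f : tree_aut T) : tree_aut T.
Proof.
exists (aut_inv f) f; [exact: aut_invK|exact: aut_funK|].
by move=> x y; rewrite -(aut_adj f) !aut_invK.
Defined.

Lemma aut_mulA : associative aut_mul.
Proof. by move=> f g h; apply: tree_aut_ext. Qed.

Lemma aut_mul1 : left_id aut_one aut_mul.
Proof. by move=> f; apply: tree_aut_ext. Qed.

Lemma aut_mulr1 : right_id aut_one aut_mul.
Proof. by move=> f; apply: tree_aut_ext. Qed.

Lemma aut_mulV : left_inverse aut_one aut_invg aut_mul.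
Proof. by move=> f; apply: tree_aut_ext => x /=; rewrite aut_funK. Qed.

Lemma aut_mulrV : right_inverse aut_one aut_invg aut_mul.
Proof. by move=> f; apply: tree_aut_ext => x /=; rewrite aut_invK. Qed.

HB.instance Definition _ := isGroup.Build (tree_aut T)
  aut_mulA aut_mul1 aut_mulr1 aut_mulV aut_mulrV.

End TreeAut.

Definition prod_aut n (T : 'I_n -> tree) := forall i, tree_aut (T i).

Section ProdAut.
Variables (n : nat) (T : 'I_n -> tree).

HB.instance Definition _ := Choice.on (prod_aut T).

Definition prod_aut_one : prod_aut T := fun=> 1.
Definition prod_aut_mul (f g : prod_aut T) : prod_aut T := fun i => f i * g i.
Definition prod_aut_inv (f : prod_aut T) : prod_aut T := fun i => (f i)^-1.

Lemma prod_aut_mulA : associative prod_aut_mul.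
Proof. by move=> f g h; apply: functional_extensionality_dep => i; apply: mulgA. Qed.

Lemma prod_aut_mul1 : left_id prod_aut_one prod_aut_mul.
Proof. by move=> f; apply: functional_extensionality_dep => i; apply: mul1g. Qed.

Lemma prod_aut_mulr1 : right_id prod_aut_one prod_aut_mul.
Proof. by move=> f; apply: functional_extensionality_dep => i; apply: mulg1. Qed.

Lemma prod_aut_mulV : left_inverse prod_aut_one prod_aut_inv prod_aut_mul.
Proof. by move=> f; apply: functional_extensionality_dep => i; apply: mulVg. Qed.

Lemma prod_aut_mulrV : right_inverse prod_aut_one prod_aut_inv prod_aut_mul.
Proof. by move=> f; apply: functional_extensionality_dep => i; apply: mulgV. Qed.

HB.instance Definition _ := isGroup.Build (prod_aut T)
  prod_aut_mulA prod_aut_mul1 prod_aut_mulr1 prod_aut_mulV prod_aut_mulrV.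

End ProdAut.

Definition prod_vertex n (T : 'I_n -> tree) := forall i, T i.

Definition stabiliser (G : groupType) n (T : 'I_n -> tree)
    (rho : {multiplicative G -> prod_aut T}) (v : prod_vertex T) : set G :=
  [set g | forall i, rho g i (v i) = v i].

Definition proper_action (G : groupType) n (T : 'I_n -> tree)
    (rho : {multiplicative G -> prod_aut T}) : Prop :=
  forall v : prod_vertex T, finite_set (stabiliser rho v).

Inductive gen := gen_a | gen_b | gen_t.

HB.instance Definition _ := gen_eqMixin gen.
HB.instance Definition _ := gen_choiceMixin gen.

Definition rels : set (word gen * word gen) :=
  let a := (gen_a, false) in
  let b := (gen_b, false) in
  let t := (gen_t, false) in
  let t' := (gen_t, true) in
  [set ([:: t; a; t'], [:: a; b]); ([:: t; b; t'], [:: b])].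

Definition G : groupType := presented rels.

(* Main.v *)
(* Put x_i = a^-i t a^i, so that b = x_1 t^-1 and x_i commutes with x_(i+1); the
   x_i are conjugate to one another.

   Two trees: if x_0 has an axis in a tree, then commutation and conjugacy force
   each x_i to translate along the same axis by the same amount, up to sign. If
   this happens in both trees, then among x_0, x_1, x_2 two have, in both trees,
   the same relative sign, so that x_i x_j or x_i x_j^-1 fixes a point of the
   product. If it happens in one tree only, then in the other one the commuting
   x_0, x_1 have a common fixed point, and x_0 x_1 or x_0 x_1^-1 will do; if it
   happens in neither, x_0 will do. All these elements have infinite order, as
   their images in the integral Heisenberg group show.

   Three trees: the Bass-Serre tree of G as an HNN extension of <b, t>, with
   stable letter a, and two lines, on which t, a, b act by n + 1, n, n and by
   n + 1, -n, n - 2 respectively. A vertex stabiliser in the first tree is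
   conjugate to <b, t>, and b^i t^j translates the two lines by j and j - 2i. *)

Require Import Defs.
From mathcomp Require Import all_boot.
From mathcomp Require Import all_classical.
From HB Require Import structures.
From mathcomp Require Import all_order all_algebra zify ring.

Set Implicit Arguments.
Unset Strict Implicit.
Unset Printing Implicit Defensive.

Import Order.TTheory GRing.Theory Num.Theory.
Local Open Scope ring_scope.

(** * Groups and presentations *)

Section ZPower.
Local Open Scope group_scope.
Variable H : groupType.
Implicit Types (x y : H) (m n : int).

Definition zpow x n : H :=
  match n with Posz k => x ^+ k | Negz k => x ^- k.+1 end.

Lemma zpowS x n : zpow x (n + 1)%R = x * zpow x n.
Proof.
case: n => k.
  by rewrite (_ : Posz k + 1 = k.+1 :> int)%R; [rewrite /zpow expgS|lia].
case: k => [|k]; first by rewrite /zpow /= expg1 mulgV.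
rewrite (_ : Negz k.+1 + 1 = Negz k :> int)%R; last by lia.
by rewrite /zpow (expgSr _ k.+1) invgM mulVKg.
Qed.

Lemma zpowD x m n : zpow x (m + n)%R = zpow x m * zpow x n.
Proof.
case: m => k; elim: k => [|k IH].
- by rewrite add0r mul1g.
- rewrite (_ : k.+1%:Z + n = k%:Z + n + 1)%R; last by lia.
  rewrite (_ : Posz k.+1 = k%:Z + 1 :> int)%R; last by lia.
  by rewrite !zpowS IH mulgA.
- by apply: (mulgI x); rewrite mulVKg -zpowS; congr zpow; lia.
- apply: (mulgI x); rewrite mulgA -!zpowS.
  rewrite (_ : Negz k.+1 + n + 1 = Negz k + n)%R; last by lia.
  by rewrite (_ : Negz k.+1 + 1 = Negz k)%R //; lia.
Qed.

Lemma zpowN x n : zpow x (- n)%R = (zpow x n)^-1.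
Proof. by apply/eqP; rewrite -mulg_eq1 -zpowD addNr. Qed.

Lemma commute_zpow x y m n : commute x y -> commute (zpow x m) (zpow y n).
Proof.
move=> xy; have V u v k : commute u v -> commute u (zpow v k).
  by move=> uv; case: k => k; [|apply: commuteV]; apply: commuteX.
exact/V/commute_sym/V/commute_sym.
Qed.

End ZPower.

(* [{multiplicative _ -> _}] does not require units to be preserved; between
   groups they are. *)
Section MultiplicativeGroup.
Local Open Scope group_scope.
Variables (H K : groupType) (f : {multiplicative H -> K}).

Lemma mult_one : f 1 = 1.
Proof. by apply: (mulgI (f 1)); rewrite -gmulfM !mulg1. Qed.

Lemma mult_inv : {morph f : x / x^-1}.
Proof. by move=> x; apply: (mulgI (f x)); rewrite -gmulfM !mulgV mult_one. Qed.

Lemma mult_expn n : {morph f : x / x ^+ n}.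
Proof.
move=> x; elim: n => [|n IH]; first by rewrite !expg0 mult_one.
by rewrite !expgS gmulfM IH.
Qed.

Lemma mult_zpow (x : H) n : f (zpow x n) = zpow (f x) n.
Proof. by case: n => k; rewrite /zpow ?mult_inv mult_expn. Qed.

End MultiplicativeGroup.

Section Component.
Variables (H : groupType) (n : nat) (T : 'I_n -> tree).
Variables (rho : {multiplicative H -> prod_aut T}) (i : 'I_n).

Definition component (g : H) : tree_aut (T i) := rho g i.

Lemma componentM : {morph component : x y / (x * y)%g}.
Proof. by move=> x y; rewrite /component gmulfM. Qed.

HB.instance Definition _ := isMultiplicative.Build _ _ component componentM.

End Component.

(** * Homomorphisms out of a presented group *)

Section UniversalProperty.
Variables (X : choiceType) (R : set (word X * word X)) (H : groupType).
Variable f : X -> H.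

Definition word_eval (w : word X) : H :=
  foldr (fun l g => (if l.2 then (f l.1)^-1 else f l.1) * g)%g 1%g w.

Lemma word_eval_cat u v : word_eval (u ++ v) = (word_eval u * word_eval v)%g.
Proof. by elim: u => [|l u IH] /=; rewrite ?mul1g // IH mulgA. Qed.

(** Every rule generating [pres_eq] preserves [word_eval], so evaluation descends to the
    quotient. *)
Lemma presented_hom :
  (forall l r, R (l, r) -> word_eval l = word_eval r) ->
  exists phi : {multiplicative presented R -> H},
    forall w, phi (pres_mk R w) = word_eval w.
Proof.
move=> fR.
have E u v : pres_eq R u v -> word_eval u = word_eval v.
  elim=> {u v} // [u v w _ -> _ -> //|u x e v|u l r v Rlr].
  - rewrite !word_eval_cat /= mulg1; congr (_ * _)%g.
    by case: e; rewrite /= ?mulVg ?mulgV mul1g.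
  - by rewrite !word_eval_cat (fR _ _ Rlr).
pose phi (g : presented R) := word_eval (repr g).
have phiE w : phi (pres_mk R w) = word_eval w by apply: E; exact: repr_pres_mk.
have phiM : {morph phi : x y / (x * y)%g}.
  by move=> x y; rewrite -[(x * y)%g]/(pres_mul x y) phiE word_eval_cat.
pose m := isMultiplicative.Build _ _ phi phiM.
by exists (HB.pack_for {multiplicative presented R -> H} phi m).
Qed.

End UniversalProperty.

Definition ga : G := pres_mk rels [:: (gen_a, false)].
Definition gb : G := pres_mk rels [:: (gen_b, false)].
Definition gt : G := pres_mk rels [:: (gen_t, false)].

Lemma rel_ta : (gt * ga * gt^-1 = ga * gb)%g.
Proof.
rewrite -[LHS]/(pres_mul (pres_mul gt ga) (pres_invg gt)).
rewrite -[RHS]/(pres_mul ga gb) /ga /gb /gt pres_invE !pres_mulE; apply/pres_mkP.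
exact: (@pres_rel gen rels [::] [:: (gen_t, false); (gen_a, false); (gen_t, true)]
  [:: (gen_a, false); (gen_b, false)] [::] (or_introl erefl)).
Qed.

Lemma rel_tb : (gt * gb * gt^-1 = gb)%g.
Proof.
rewrite -[LHS]/(pres_mul (pres_mul gt gb) (pres_invg gt)).
rewrite /gb /gt pres_invE !pres_mulE; apply/pres_mkP.
exact: (@pres_rel gen rels [::] [:: (gen_t, false); (gen_b, false); (gen_t, true)]
  [:: (gen_b, false)] [::] (or_intror erefl)).
Qed.

Lemma commute_tb : commute gt gb.
Proof. by apply/eqP; rewrite -divg_eq rel_tb. Qed.

Lemma G_hom (H : groupType) (a b t : H) :
  (t * a * t^-1 = a * b)%g -> (t * b * t^-1 = b)%g ->
  exists phi : {multiplicative G -> H}, [/\ phi ga = a, phi gb = b & phi gt = t].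
Proof.
move=> ta tb.
pose f x := match x with gen_a => a | gen_b => b | gen_t => t end.
have [|phi phiE] := @presented_hom gen rels H f.
  by move=> l r [] [-> ->] /=; rewrite !mulg1 ?mulgA.
by exists phi; rewrite !phiE /= !mulg1.
Qed.

Lemma G_ind (P : G -> Prop) : P 1%g ->
  (forall c g, c \in [:: ga; gb; gt] -> P g -> P (c * g)%g) ->
  (forall c g, c \in [:: ga; gb; gt] -> P g -> P (c^-1 * g)%g) ->
  forall g, P g.
Proof.
move=> P1 PM PV g; rewrite -(pres_reprK g); elim: (repr g) => [|[x e] w IH] //.
pose c : G := pres_mk rels [:: (x, false)].
have hc : c \in [:: ga; gb; gt] by rewrite !inE /c /ga /gb /gt; case: (x); rewrite eqxx ?orbT.
have cE : pres_mk rels ((x, e) :: w) =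
    ((if e then c^-1 else c) * pres_mk rels w)%g :> G.
  case: e; last by rewrite -[RHS]/(pres_mul _ _) pres_mulE.
  by rewrite -[RHS]/(pres_mul (pres_invg _) _) pres_invE pres_mulE.
by rewrite cE; case: (e); [apply: PV|apply: PM].
Qed.

(** * Geodesics and axes in trees *)

Section Geodesics.
Variable T : tree.
Implicit Types (x y : T) (p q : seq T).

(** Past their common beginning, two distinct simple paths with the same ends would enclose a
    cycle. *)
Lemma simple_path_unique x p q :
  path (@adj T) x p -> path (@adj T) x q -> uniq (x :: p) -> uniq (x :: q) ->
  last x p = last x q -> p = q.
Proof.
elim: p x q => [|u p IH] x [|v q] //.
- by move=> _ _ _ /andP[xq _] /= e; case/negP: xq; rewrite e mem_last.
- by move=> _ _ /andP[xp _] _ /= e; case/negP: xp; rewrite -e mem_last.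
have [<-|uv] := eqVneq u v.
  move=> /andP[_ pp] /andP[_ qq] /andP[_ up] /andP[_ uq] /= e.
  by rewrite (IH u q).
move=> hp hq up uq e.
have hasp : has (mem (v :: q)) (u :: p).
  apply/hasP; exists (last u p); first exact: mem_last.
  by move: e => /= ->; exact: mem_last.
move: (u :: p) hasp hp up e (erefl : head x (u :: p) = u) => P hPQ.
(* [z] is the first vertex at which the first path meets the second again; the cycle runs out to [z]
   along the first path and back to [x] along the second. *)
case: (split_find hPQ) => z p1 p2 /= zq p1q hp up _ eu.
move: zq p1q hq uq uv (erefl : head x (v :: q) = v); move: (v :: q) => Q.
case/path.splitP => q1 q2 p1q hq uq uv ev.
exfalso; apply: (@tree_acyclic T (x :: rcons p1 z ++ rev q1)).
  rewrite /= size_cat size_rcons size_rev.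
  case: p1 eu {p1q hp up} => [|? ?]; case: q1 ev {hq uq} => [|? ?] //=;
    try by move=> *; lia.
  by move=> /= ev eu; move: uv; rewrite -eu -ev eqxx.
move: hp hq; rewrite !cat_path => /andP[hp _] /andP[hq _].
apply/andP; split.
  rewrite /= rcons_cat cat_path hp last_rcons /=.
  move: hq; rewrite -rev_path last_rcons belast_rcons rev_cons.
  by apply: sub_path => a b /=; rewrite adj_sym.
move: up uq; rewrite -?cons_uniq -!cat_cons !(cat_uniq (x :: _)).
move=> /and3P[up _ _] /and3P[uq _ _]; move: uq; rewrite up cons_uniq rev_uniq.
rewrite rcons_uniq mem_rcons inE negb_or => /andP[/andP[xz xq] /andP[zq ->]].
rewrite andbT; apply/hasPn => w; rewrite mem_rev => wq.
rewrite inE mem_rcons inE !negb_or; apply/and3P; split.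
- by apply: contraNneq xq => <-.
- by apply: contraNneq zq => <-.
apply: contra p1q => wp; apply/hasP; exists w => //=.
by rewrite mem_cat mem_rcons inE wq orbT.
Qed.

(** Cutting the loops out of [q] leaves a simple path, which is [p] by uniqueness. *)
Lemma simple_path_sub x p q :
  path (@adj T) x p -> uniq (x :: p) -> path (@adj T) x q ->
  last x p = last x q -> {subset p <= q} /\ (size p <= size q)%N.
Proof.
move=> hp up hq e; move: e; case/shortenP: hq => q' hq' uq' sq e.
rewrite (simple_path_unique hp hq' up uq' e); split=> //.
by apply: uniq_leq_size => //; case/andP: uq'.
Qed.

Lemma path_rev x p : path (@adj T) x p ->
  exists q, [/\ path (@adj T) (last x p) q, last (last x p) q = x,
                 size q = size p & {subset q <= x :: p}].
Proof.
move=> hp; exists (rev (belast x p)); split.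
- by move: hp; rewrite -rev_path; apply: sub_path => a b /=; rewrite adj_sym.
- by case: p {hp} => [|u p] //=; rewrite rev_cons last_rcons.
- by rewrite size_rev size_belast.
- by move=> v; rewrite mem_rev => /mem_belast.
Qed.

(* A bi-infinite path without backtracking; in a tree it is a geodesic. *)
Definition geodesic_line (c : int -> T) : Prop :=
  forall i, adj (c i) (c (i + 1)) /\ c i != c (i + 2).

Definition line_seg (c : int -> T) (i : int) (n : nat) : seq T :=
  [seq c (i + k%:Z) | k <- iota 1 n].

Lemma line_segS c i n : line_seg c i n.+1 = c (i + 1) :: line_seg c (i + 1) n.
Proof.
rewrite /line_seg /=; congr (_ :: _).
rewrite (iotaDl 1 1 n) -map_comp; apply: eq_map => k /=; congr c; lia.
Qed.

Lemma size_line_seg c i n : size (line_seg c i n) = n.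
Proof. by rewrite size_map size_iota. Qed.

Lemma last_line_seg c i n : last (c i) (line_seg c i n) = c (i + n%:Z).
Proof.
elim: n i => [|n IH] i; first by rewrite addr0.
by rewrite line_segS /= IH; congr c; lia.
Qed.

Lemma line_seg_path c i n :
  geodesic_line c -> path (@adj T) (c i) (line_seg c i n).
Proof.
move=> gc; elim: n i => [|n IH] i //.
by rewrite line_segS /= IH andbT; case: (gc i).
Qed.

(** By induction the segment after [c i] is simple, so a recurrence of [c i] would close up a cycle;
    a recurrence after one or two steps is excluded by irreflexivity and the absence of
    backtracking. *)
Lemma line_seg_uniq c i n : geodesic_line c -> uniq (c i :: line_seg c i n).
Proof.
move=> gc; elim: n i => [|n IH] i //.
rewrite line_segS cons_uniq IH andbT; apply/negP.
rewrite -line_segS => /mapP[[|k]]; rewrite mem_iota // => /andP[_ kn] e.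
case: k kn e => [|[|k]] kn e.
- by have [] := gc i; rewrite -e adj_irr.
- by have [_] := gc i; rewrite -e eqxx.
have sub : prefix (c (i + 1) :: line_seg c (i + 1) k.+2)
                  (c (i + 1) :: line_seg c (i + 1) n).
  rewrite prefix_cons eqxx /= /line_seg; apply/prefixP.
  exists [seq c (i + 1 + j%:Z) | j <- iota (1 + k.+2) (n - k.+2)].
  by rewrite -map_cat -iotaD subnKC //; lia.
apply: (@tree_acyclic T (c (i + 1) :: line_seg c (i + 1) k.+2)) => //.
rewrite /ucycle; apply/andP; split; last first.
  by case/prefixP: sub => s es; have := IH (i + 1); rewrite es cat_uniq => /andP[].
rewrite /cycle rcons_path line_seg_path // last_line_seg.
have -> : i + 1 + k.+2%:Z = i + k.+3%:Z by lia.
by rewrite -e; case: (gc i).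
Qed.

Lemma geodesic_dist c i j p : geodesic_line c ->
  path (@adj T) (c i) p -> last (c i) p = c j -> (`|i - j| <= size p)%N.
Proof.
move=> gc; wlog ij : i j p / i <= j.
  move=> W hp e; case: (leP i j) => [ij|/ltW ij]; first exact: W.
  have [q []] := path_rev hp; rewrite e => hq eq <- _.
  by rewrite distnC; apply: W.
move=> hp e; have ej : j = i + `|i - j|%N by lia.
rewrite -{1}(size_line_seg c i `|i - j|%N).
have [//|//|//||//] := @simple_path_sub (c i) (line_seg c i `|i - j|) p.
- exact: line_seg_path.
- exact: line_seg_uniq.
by rewrite last_line_seg e -ej.
Qed.

Lemma geodesic_inj c : geodesic_line c -> injective c.
Proof. by move=> gc i j e; have /= := @geodesic_dist c i j [::] gc isT e; lia. Qed.

Lemma geodesic_mem_dist c i j p : geodesic_line c ->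
  path (@adj T) (c i) p -> c j \in c i :: p -> (`|i - j| <= size p)%N.
Proof.
move=> gc hp; rewrite inE => /predU1P[/(geodesic_inj gc)|jp]; first by lia.
move: jp hp => /path.splitPr[p1 p2]; rewrite -cat_rcons cat_path => /andP[hp1 _].
have := geodesic_dist gc hp1 (last_rcons _ _ _).
by rewrite size_cat size_rcons /=; lia.
Qed.

Lemma geodesic_adj c i j : geodesic_line c -> adj (c i) (c j) ->
  j = i + 1 \/ j = i - 1.
Proof.
move=> gc ad; have : (`|i - j| <= 1)%N.
  by apply: (@geodesic_dist c i j [:: c j]) => //=; rewrite ad.
have : i != j by apply: contraTneq ad => ->; rewrite adj_irr.
lia.
Qed.

(* Two lines which stay at bounded distance towards both ends coincide: the
   geodesic between far away points of [c] is contained in any path between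
   them, in particular in one which runs along [d] except near its ends. *)
Lemma close_lines c d D : geodesic_line c -> geodesic_line d ->
  (forall N : nat, exists (i j : int) p, [/\ N%:Z <= i, path (@adj T) (c i) p,
      last (c i) p = d j & size p = D]) ->
  (forall N : nat, exists (i j : int) p, [/\ i <= - N%:Z, path (@adj T) (c i) p,
      last (c i) p = d j & size p = D]) ->
  forall k, exists j, c k = d j.
Proof.
move=> gc gd hpos hneg k.
(* The margin puts both ends more than [D] steps away from [c k], so that [p] and [p'] cannot pass
   through [c k]. *)
have [i [j [p [hi hp ep sp]]]] := hpos (`|k| + D).+1.
have [i' [j' [p' [hi' hp' ep' sp']]]] := hneg (`|k| + D).+1.
(* The order of [j'] and [j] is unknown, so the segment of [d] may have to be run backwards. *)
have [q hq eq] : exists2 q, path (@adj T) (d j') q &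
    last (d j') q = d j /\ forall v, v \in q -> exists m, v = d m.
  case: (leP j' j) => jj.
    exists (line_seg d j' `|j - j'|); first exact: line_seg_path.
    split; first by rewrite last_line_seg; congr d; lia.
    by move=> v /mapP[m _ ->]; exists (j' + m%:Z).
  have ej : last (d j) (line_seg d j `|j' - j|) = d j'.
    by rewrite last_line_seg; congr d; lia.
  have [q []] := path_rev (line_seg_path j `|j' - j| gd); rewrite ej => hq eq _ sq.
  exists q => //; split=> // v /sq; rewrite inE => /predU1P[->|]; first by exists j.
  by move=> /mapP[m _ ->]; exists (j + m%:Z).
case: eq => eq dq.
have [r []] := path_rev hp; rewrite ep => hr er _ sr.
have hseg := line_seg_path i' `|i - i'| gc.
have hpqr : path (@adj T) (c i') (p' ++ q ++ r).
  by rewrite !cat_path hp' ep' hq eq hr.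
have epqr : last (c i') (line_seg c i' `|i - i'|) = last (c i') (p' ++ q ++ r).
  by rewrite last_line_seg !last_cat ep' eq er; congr c; lia.
have [sub _] := simple_path_sub hseg (line_seg_uniq i' `|i - i'| gc) hpqr epqr.
have : c k \in line_seg c i' `|i - i'|.
  apply/mapP; exists `|k - i'|%N; first by rewrite mem_iota; lia.
  congr c; lia.
move/sub; rewrite !mem_cat => /or3P[|/dq //|].
  by move=> kp'; have := geodesic_mem_dist gc hp' (@mem_behead _ (_ :: _) _ kp'); lia.
by move/sr/(geodesic_mem_dist gc hp); lia.
Qed.

(** The change of parameter [s] moves by [1] or [-1] at each step, and since [c] does not backtrack
    the sign never changes. *)
Lemma sub_line_affine c d : geodesic_line c -> geodesic_line d ->
  (forall k, exists j, c k = d j) ->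
  exists e m : int, (e = 1 \/ e = -1) /\ forall i, c i = d (e * i + m).
Proof.
move=> gc gd cd.
have [s sE] : exists s : int -> int, forall k, c k = d (s k).
  by exists (fun k => projT1 (cid (cd k))) => k; exact: (projT2 (cid (cd k))).
have [e eE] : exists e : int, e = s 1 - s 0 by eexists.
have step (k : int) : s (k + 1) = s k + 1 \/ s (k + 1) = s k - 1.
  by apply: (geodesic_adj gd); rewrite -!sE; case: (gc k).
have step2 (k : int) : s (k + 2) <> s k.
  by move=> h; case: (gc k) => _; rewrite !sE h eqxx.
have he : e = 1 \/ e = -1 by have := step 0; rewrite add0r; lia.
exists e, (s 0); split=> // i; rewrite sE; congr d.
have const (k : int) : s (k + 1) - s k = e <-> s (k + 2) - s (k + 1) = e.
  have := step k; have := step (k + 1); have := step2 k.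
  rewrite -addrA (_ : 1 + 1 = 2) //.
  by move: (s (k + 2)) (s (k + 1)) (s k) {eE} he => u v w he; lia.
have diff (k : int) : s (k + 1) - s k = e.
  case: k => k; elim: k => [|k IH].
  - by rewrite eE add0r.
  - have -> : k.+1%:Z = k%:Z + 1 by lia.
    by rewrite -addrA (_ : 1 + 1 = 2) //; apply/const.
  - by apply/const; rewrite eE.
  - apply/const; have -> : Negz k.+1 + 1 = Negz k by lia.
    by have -> : Negz k.+1 + 2 = Negz k + 1 by lia.
have nonneg (n : nat) : s n = e * n + s 0.
  elim: n => [|n IH]; first by rewrite mulr0 add0r.
  have := diff n; have -> : n.+1%:Z = n%:Z + 1 by lia.
  by rewrite IH; lia.
have neg (n : nat) : s (- n%:Z) = - e * n + s 0.
  elim: n => [|n IH]; first by rewrite mulr0 oppr0 add0r.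
  have := diff (- n.+1%:Z); have -> : - n.+1%:Z + 1 = - n%:Z by lia.
  by rewrite IH; lia.
case: (leP 0 i) => i0.
  by have := nonneg `|i|%N; rewrite gez0_abs.
by have := neg `|i|%N; rewrite ltz0_abs // opprK mulrNN.
Qed.

End Geodesics.

(** * Axes of tree automorphisms *)

Section Axes.
Variable T : tree.
Implicit Types (f g h k : tree_aut T) (c d : int -> T) (l m : int).

(** The translation length is signed and may be [0], so that automorphisms with a given axis [c] are
    closed under products and inverses. *)
Definition axis f c l : Prop := geodesic_line c /\ forall i, f (c i) = c (i + l).

Lemma axis_mul f g c l m : axis f c l -> axis g c m -> axis (f * g)%g c (m + l).
Proof. by move=> [gc fc] [_ gcm]; split=> // i; rewrite /= gcm fc addrA. Qed.

Lemma axis_inv f c l : axis f c l -> axis f^-1%g c (- l).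
Proof. by case=> gc fc; split=> // i; rewrite -[RHS](@aut_funK _ f) fc subrK. Qed.

Lemma axis_expn f c l n : axis f c l -> axis (f ^+ n)%g c (n%:Z * l).
Proof.
move=> ax; elim: n => [|n IH].
  by rewrite expg0 mul0r; case: ax => gc _; split=> // i; rewrite addr0.
by rewrite expgS -addn1 PoszD mulrDl mul1r; apply: axis_mul.
Qed.

Lemma geodesic_line_aut f c : geodesic_line c -> geodesic_line (f \o c).
Proof.
move=> gc i; have [a b] := gc i; rewrite /= aut_adj; split=> //.
by rewrite (can_eq (@aut_funK _ f)).
Qed.

Lemma path_aut f x p : path (@adj T) x p -> path (@adj T) (f x) (map f p).
Proof. by rewrite (mono_path (e' := @adj T) (@aut_adj _ f)). Qed.

(* Choose [v] with minimal displacement: if the geodesic from [v] to [f v] and its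
   translate backtracked at [f v], then moving [v] one step along it would
   decrease the displacement by 2. *)
Lemma exists_axis f :
  (exists v, f (f v) = v) \/ exists c l, l != 0 /\ axis f c l.
Proof.
pose P n := `[< exists v p, [/\ path (@adj T) v p, uniq (v :: p),
  last v p = f v & size p = n] >].
have exP v q : path (@adj T) v q -> last v q = f v ->
    exists2 n, P n & (n <= size q)%N.
  move=> hq; case/shortenP: hq => q' hq' uq' sq eq; exists (size q').
    by apply/asboolP; exists v, q'.
  by apply: uniq_leq_size => //; case/andP: uq'.
have ex : exists n, P n.
  case: (tree_inh T) => v; have [q hq eq] := tree_conn v (f v).
  by have [n Pn _] := exP v q hq (esym eq); exists n.
case: (ex_minnP ex) => n /asboolP[v [p [hp up ep sp]]] minP.
have min w q : path (@adj T) w q -> last w q = f w -> (n <= size q)%N.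
  by move=> hq eq; have [m /minP nm /(leq_trans nm)] := exP w q hq eq.
case: (pselect (f (f v) = v)) => ffv; [by left; exists v|right].
have n0 : (0 < n)%N.
  by case: (p) sp ep => [|? ?] <- //= ev; case: ffv; rewrite -!ev.
(* The translates of the geodesic from [v] to [f v] under the powers of [f], laid end to end:
   [i = q n + r] goes to the [r]-th vertex of the [q]-th translate. *)
pose c (i : int) : T := zpow f (i %/ n%:Z)%Z (nth v (v :: p) `|(i %% n%:Z)%Z|%N).
have cn (i : int) : c (i + n) = f (c i).
  rewrite /c modzDr -{1}[n%:Z]mul1r [X in (X %/ _)%Z]addrC divzMDl; last by lia.
  by rewrite addrC zpowS.
have cr (r : nat) : (r <= n)%N -> c r = nth v (v :: p) r.
  rewrite leq_eqVlt => /predU1P[->|rn].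
    by rewrite -[n%:Z]add0r cn -sp nth_last /= ep /c div0z mod0z.
  by rewrite /c divz_small ?modz_small //; lia.
exists c, n; split; first by lia.
split=> //.
(* The condition is local and invariant under shifting [i] by [n], so one period suffices. *)
pose Q (i : int) := adj (c i) (c (i + 1)) /\ c i != c (i + 2).
have Qn (i : int) : Q (i + n) <-> Q i.
  rewrite /Q !(addrAC i n%:Z) !cn aut_adj (can_eq (@aut_funK _ f)) //.
have Qk (q r : int) : Q (r + q * n) <-> Q r.
  case: q => q; elim: q => [|q IH].
  - by rewrite mul0r addr0.
  - have -> : r + q.+1%:Z * n = r + q%:Z * n + n by rewrite intS mulrDl mul1r; lia.
    exact: iff_trans (Qn _) IH.
  - have {2}-> : r = r + Negz 0 * n + n by lia.
    exact: iff_sym (Qn _).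
  - have e : r + Negz q * n = r + Negz q.+1 * n + n.
      by rewrite !NegzE !intS !mulNr !mulrDl mul1r; lia.
    by apply: iff_trans IH; rewrite e; apply: iff_sym (Qn _).
suff Qr (r : nat) : (r < n)%N -> Q r.
  move=> i; rewrite [i](divz_eq i n%:Z) addrC; apply/Qk.
  have r0 : 0 <= (i %% n%:Z)%Z by apply: modz_ge0; lia.
  have rn : (i %% n%:Z)%Z < n by apply: ltz_pmod; lia.
  by rewrite -(gez0_abs r0); apply: Qr; lia.
move=> rn; split.
  rewrite (_ : r%:Z + 1 = r.+1) ?cr //; try lia.
  by move/(pathP v): hp; apply; rewrite sp.
have [r2|r2] := leqP r.+2 n.
  rewrite (_ : r%:Z + 2 = r.+2) ?cr //; try lia.
  by rewrite nth_uniq //= ?sp; lia.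
(* Only [r = n - 1] is left, where the path turns into its translate at [f v]. *)
have -> : r%:Z + 2 = 1%N%:Z + n%:Z by lia.
rewrite cn !cr //; try lia.
apply/eqP; case: p => [|u p] in hp up ep sp {c cn cr Q Qn Qk} *; first by move: n0; rewrite -sp.
case/lastP: p => [|p w] in hp up ep sp *.
  move: ep sp => /= -> sp e; apply: ffv.
  by rewrite -e (_ : r = 0)%N //; lia.
move: hp sp; rewrite /= rcons_path size_rcons => /andP[_ /andP[hp _]] sp e.
suff /(min u p hp) : last u p = f u by lia.
rewrite -e (_ : r = (size p).+1) /=; last by lia.
by rewrite -rcons_cons nth_rcons ltnSn (last_nth v).
Qed.

(** The powers of [f] carry a fixed path from [c 0] to [d 0] to paths of the same length between
    points arbitrarily far out on [c] and points of [d], so [close_lines] applies. *)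
Lemma axis_unique f c d l m : axis f c l -> l != 0 -> axis f d m ->
  exists e s : int, (e = 1 \/ e = -1) /\ forall i, c i = d (e * i + s).
Proof.
wlog l0 : f l m / 0 < l => [W ac l0 ad|ac _ ad].
  case: (ltP 0 l) => ll; first exact: W ac l0 ad.
  by apply: (W _ (- l) _ _ (axis_inv ac) _ (axis_inv ad)); lia.
have [p hp ep] := tree_conn (c 0) (d 0).
have [gc _] := ac; have [gd _] := ad.
apply: sub_line_affine => //; apply: (close_lines gc gd (D := size p)) => N.
  have [_ hc] := axis_expn N ac; have [_ hd] := axis_expn N ad.
  exists (N%:Z * l), (N%:Z * m), (map (f ^+ N)%g p).
  rewrite -[N%:Z * l]add0r -[N%:Z * m]add0r -hc -hd last_map size_map path_aut //.
  by split=> //; [nia|rewrite -ep].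
have [_ hc] := axis_inv (axis_expn N ac); have [_ hd] := axis_inv (axis_expn N ad).
exists (- (N%:Z * l)), (- (N%:Z * m)), (map (f ^- N)%g p).
rewrite -[- (N%:Z * l)]add0r -[- (N%:Z * m)]add0r -hc -hd last_map size_map path_aut //.
by split=> //; [nia|rewrite -ep].
Qed.

(** [h] maps [c] to another axis of [f], hence to [c] up to reparametrisation; a reflection of [c]
    would not commute with a nonzero translation. *)
Lemma axis_commute f h c l : axis f c l -> l != 0 -> commute f h ->
  exists s, axis h c s.
Proof.
move=> ac l0 fh; have [gc fc] := ac.
have fhx x : f (h x) = h (f x) by have := congr1 (fun k => aut_fun k x) fh.
have ah : axis f (h \o c) l.
  by split=> [|i /=]; [exact: geodesic_line_aut|rewrite fhx fc].
have [e [s [he hs]]] := axis_unique ah l0 ac.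
have : e * (0 + l) + s = e * 0 + s + l.
  apply: (geodesic_inj gc); rewrite -hs -fc -hs /=.
  by rewrite fhx fc.
exists s; split=> // i; rewrite -[h _]/((h \o c) i) hs.
by congr c; case: he => he; subst e; lia.
Qed.

(** [h] translates along [c] because it commutes with [f], and along the preimage of [c] under [k],
    by [l], because it is conjugate to [f]. By uniqueness of axes the two lengths agree up to
    sign. *)
Lemma axis_commute_conj f h k c l : axis f c l -> l != 0 -> commute f h ->
  (k * h = f * k)%g -> axis h c l \/ axis h c (- l).
Proof.
move=> ac l0 fh kh; have [gc fc] := ac.
have [s as_] := axis_commute ac l0 fh; have [_ hc] := as_.
have khx x : k (h x) = f (k x) by have := congr1 (fun g => aut_fun g x) kh.
pose c' := aut_inv k \o c.
have ac' : axis h c' l.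
  split=> [|i]; first exact: (@geodesic_line_aut k^-1%g).
  by rewrite /c' /= -[h _](@aut_funK _ k) khx aut_invK fc.
have [e [m [he hm]]] := axis_unique ac' l0 as_.
have : e * (0 + l) + m = e * 0 + m + s.
  by apply: (geodesic_inj gc); rewrite -hm -hc -hm (proj2 ac').
case: he => -> es; [left|right].
- by have -> : l = s by lia.
- by have -> : - l = s by lia.
Qed.

(** Powers of [f * f] fix [v], so they move [c 0] by at most twice its distance from [v]; for [l]
    nonzero the power [N] moves it further. *)
Lemma axis_elliptic f c l v : axis f c l -> f (f v) = v -> l = 0.
Proof.
move=> ac ffv; have [p hp ep] := tree_conn v (c 0).
have [gc _] := ac; pose N := (size p).+1.
have [_ hc] := axis_expn N (axis_mul ac ac).
have hN : ((f * f) ^+ N)%g v = v.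
  by elim: (N) => [|j IH] //; rewrite expgS /= IH ffv.
have [q [hq eq sq _]] := path_rev hp.
have hp' := path_aut ((f * f) ^+ N)%g hp; rewrite hN in hp'.
have el : last v (map ((f * f) ^+ N)%g p) = c (0 + N%:Z * (l + l)).
  by rewrite -hc ep -{1}hN last_map.
have := @geodesic_dist _ c 0 (0 + N%:Z * (l + l)) (q ++ map ((f * f) ^+ N)%g p) gc.
rewrite ep cat_path last_cat hq eq hp' el size_cat size_map sq.
by move=> /(_ erefl erefl); nia.
Qed.

End Axes.

(** * Two trees *)

(* [(p, q, k)] is the affine map [(x, y) |-> (x + k y + p, y + q)]. *)
Definition heis : Type := (int * int * int)%type.
HB.instance Definition _ := Choice.on heis.

Definition heis_mul (g h : heis) : heis :=
  (g.1.1 + h.1.1 + g.2 * h.1.2, g.1.2 + h.1.2, g.2 + h.2).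
Definition heis_inv (g : heis) : heis :=
  (- g.1.1 + g.2 * g.1.2, - g.1.2, - g.2).

Lemma heis_mulA : associative heis_mul.
Proof.
by move=> [[p q] k] [[p' q'] k'] [[p'' q''] k'']; congr (_, _, _) => /=; ring.
Qed.
Lemma heis_mul1 : left_id (0, 0, 0) heis_mul.
Proof. by move=> [[p q] k]; congr (_, _, _) => /=; ring. Qed.
Lemma heis_mulr1 : right_id (0, 0, 0) heis_mul.
Proof. by move=> [[p q] k]; congr (_, _, _) => /=; ring. Qed.
Lemma heis_mulV : left_inverse (0, 0, 0) heis_inv heis_mul.
Proof. by move=> [[p q] k]; congr (_, _, _) => /=; ring. Qed.
Lemma heis_mulrV : right_inverse (0, 0, 0) heis_inv heis_mul.
Proof. by move=> [[p q] k]; congr (_, _, _) => /=; ring. Qed.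

HB.instance Definition _ := isGroup.Build heis
  heis_mulA heis_mul1 heis_mulr1 heis_mulV heis_mulrV.

Lemma heis_expn (p q : int) n :
  (((p, q, 0) : heis) ^+ n)%g = (n%:Z * p, n%:Z * q, 0).
Proof.
elim: n => [|n IH]; first by rewrite expg0 !mul0r.
by rewrite expgS IH; congr (_, _, _) => /=; lia.
Qed.

(** [ga] becomes a shear, [gb] and [gt] translations of the plane; this representation detects
    elements of infinite order. *)
Lemma G_heis : exists chi : {multiplicative G -> heis},
  [/\ chi ga = (0, 0, 1), chi gb = (-1, 0, 0) & chi gt = (0, 1, 0)].
Proof. by apply: G_hom; congr (_, _, _). Qed.

(** * Elements of infinite order that are elliptic in both trees *)

Section NoTwoTrees.
Local Open Scope group_scope.

Let x0 : G := gt.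
Let x1 : G := ga^-1 * x0 * ga.
Let x2 : G := ga^-1 * x1 * ga.

Lemma commute_x01 : commute x0 x1.
Proof.
have -> : x1 = gb * gt.
  by rewrite /x1 -mulgA -[x0 * ga](mulgVK gt) rel_ta -mulgA mulKg.
exact: commuteM commute_tb (commute_refl _).
Qed.

Lemma commute_x12 : commute x1 x2.
Proof.
have -> : x1 = x0 ^ ga by rewrite conjgE mulgA.
have -> : x2 = x1 ^ ga by rewrite conjgE mulgA.
by rewrite /commute -!conjMg commute_x01.
Qed.

(* [f] fixes a vertex or the midpoint of an edge. *)
Definition elliptic (T : tree) (f : tree_aut T) : Prop := exists v, f (f v) = v.

Lemma elliptic_inv (T : tree) (f : tree_aut T) : elliptic f -> elliptic f^-1.
Proof. by case=> v fv; exists v; rewrite -{1}fv /= !aut_funK. Qed.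

(** If [f * g] had an axis with nonzero translation, then [f] and [g], which commute with it, would
    translate along that axis, by [0] as they are elliptic. *)
Lemma elliptic_mul (T : tree) (f g : tree_aut T) :
  commute f g -> elliptic f -> elliptic g -> elliptic (f * g).
Proof.
move=> fg [v fv] [w gw]; case: (exists_axis (f * g)) => // -[c [l [l0 ax]]].
have [s fs] : exists s, axis f c s.
  by apply: axis_commute ax l0 _; apply: commute_sym; apply: commuteM.
have [s' gs] : exists s, axis g c s.
  apply: axis_commute ax l0 _; apply: commute_sym.
  by apply: commuteM => //; apply: commute_sym.
have [gc hc] := axis_mul fs gs; have := proj2 ax 0; rewrite hc.
move/(geodesic_inj gc); rewrite (axis_elliptic fs fv) (axis_elliptic gs gw).
by move=> e; move: l0; rewrite -[l]add0r -e eqxx.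
Qed.

(** Equal translations cancel in the quotient, opposite ones in the product, which then fixes [c]
    pointwise. *)
Lemma axis_quotient_elliptic (T : tree) (f g : tree_aut T) c (l e e' : int) :
  (e = 1 \/ e = -1)%R -> (e' = 1 \/ e' = -1)%R ->
  axis f c (e * l)%R -> axis g c (e' * l)%R ->
  elliptic (if (e == e')%R then f * g^-1 else f * g).
Proof.
move=> he he' fc gc.
have h0 : axis (if (e == e')%R then f * g^-1 else f * g) c 0%R.
  case: eqP => [ee|ee]; first by have := axis_mul fc (axis_inv gc); rewrite ee addNr.
  have := axis_mul fc gc; rewrite -mulrDl (_ : e' + e = 0)%R ?mul0r //; lia.
by exists (c 0%R); rewrite !(proj2 h0) !addr0.
Qed.

(** [x2] is compared with [x1] rather than with [x0], since only consecutive elements are known to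
    commute. *)
Lemma elliptic_or_axis (T : tree) (r : {multiplicative G -> tree_aut T}) :
  elliptic (r x0) \/
  exists c l (e1 e2 : int), [/\ (e1 = 1 \/ e1 = -1)%R, (e2 = 1 \/ e2 = -1)%R,
    axis (r x0) c l, axis (r x1) c (e1 * l)%R & axis (r x2) c (e2 * l)%R].
Proof.
case: (exists_axis (r x0)) => [|[c [l [l0 a0]]]]; [by left|right].
have rE x y : x * y = y * x -> commute (r x) (r y) by exact: gmulf_commute.
have c1 : r ga * r x1 = r x0 * r ga by rewrite -!gmulfM /x1 -mulgA mulVKg.
have c2 : r ga * r x2 = r x1 * r ga by rewrite -!gmulfM /x2 -mulgA mulVKg.
have [e1 he1 a1] : exists2 e1, (e1 = 1 \/ e1 = -1)%R & axis (r x1) c (e1 * l)%R.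
  have [a1|a1] := axis_commute_conj a0 l0 (rE _ _ commute_x01) c1.
  - by exists 1%R; [left|rewrite mul1r].
  - by exists (-1)%R; [right|rewrite mulN1r].
have l1 : (e1 * l != 0)%R by lia.
exists c, l, e1; case: (axis_commute_conj a1 l1 (rE _ _ commute_x12) c2) => a2.
- by exists e1.
- by exists (- e1)%R; split=> //; [lia|rewrite mulNr].
Qed.

Lemma elliptic_conj (T : tree) (f k h : tree_aut T) :
  k * h = f * k -> elliptic f -> elliptic h.
Proof.
move=> kh [v fv]; have khx x : k (h x) = f (k x).
  by have := congr1 (fun g => aut_fun g x) kh.
exists (aut_inv k v); apply: (can_inj (@aut_funK _ k)).
by rewrite !khx !aut_invK.
Qed.

(** A list independent of the trees, so that infinite order is checked once and for all. *)
Definition candidates : seq G :=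
  [:: x0; x0 * x1; x0 * x1^-1; x0 * x2; x0 * x2^-1; x1 * x2; x1 * x2^-1].

(** In [T] both [x0] and its conjugate [x1] are elliptic and commute, so either sign will do; the
    sign is dictated by [T']. *)
Lemma candidate_mixed (T T' : tree) (r : {multiplicative G -> tree_aut T})
    (r' : {multiplicative G -> tree_aut T'}) c l (e : int) :
  elliptic (r x0) -> (e = 1 \/ e = -1)%R ->
  axis (r' x0) c l -> axis (r' x1) c (e * l)%R ->
  exists y, [/\ y \in candidates, elliptic (r y) & elliptic (r' y)].
Proof.
move=> ell0 he a0 a1; exists (if (1 == e)%R then x0 * x1^-1 else x0 * x1).
have ell1 : elliptic (r x1).
  by apply: (elliptic_conj (k := r ga)) ell0; rewrite -!gmulfM /x1 -mulgA mulVKg.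
have com : commute (r x0) (r x1) := gmulf_commute r commute_x01.
split.
- by case: ifP; rewrite !inE eqxx ?orbT.
- case: ifP => _; rewrite gmulfM ?mult_inv; apply: elliptic_mul => //.
    exact: commuteV com.
  exact: elliptic_inv.
- rewrite -[l]mul1r in a0.
  have := axis_quotient_elliptic (or_introl erefl) he a0 a1.
  by case: ifP => _; rewrite gmulfM ?mult_inv.
Qed.

Lemma candidate_pair (T T' : tree) (r : {multiplicative G -> tree_aut T})
    (r' : {multiplicative G -> tree_aut T'}) (x y : G) c c' l l' (e f e' f' : int) :
  x * y \in candidates -> x * y^-1 \in candidates ->
  (e = 1 \/ e = -1)%R -> (f = 1 \/ f = -1)%R ->
  (e' = 1 \/ e' = -1)%R -> (f' = 1 \/ f' = -1)%R ->
  (e == f)%R = (e' == f')%R ->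
  axis (r x) c (e * l)%R -> axis (r y) c (f * l)%R ->
  axis (r' x) c' (e' * l')%R -> axis (r' y) c' (f' * l')%R ->
  exists y, [/\ y \in candidates, elliptic (r y) & elliptic (r' y)].
Proof.
move=> c1 c2 he hf he' hf' ef ax ay ax' ay'.
exists (if (e == f)%R then x * y^-1 else x * y); split.
- by case: ifP.
- have := axis_quotient_elliptic he hf ax ay.
  by case: ifP => _; rewrite gmulfM ?mult_inv.
- rewrite ef; have := axis_quotient_elliptic he' hf' ax' ay'.
  by case: ifP => _; rewrite gmulfM ?mult_inv.
Qed.

Lemma candidate_exists (T T' : tree) (r : {multiplicative G -> tree_aut T})
    (r' : {multiplicative G -> tree_aut T'}) :
  exists y, [/\ y \in candidates, elliptic (r y) & elliptic (r' y)].
Proof.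
case: (elliptic_or_axis r) => [ell|[c [l [e1 [e2 [he1 he2 a0 a1 a2]]]]]].
  case: (elliptic_or_axis r') => [ell'|[c [l [e1 [e2 [he1 _ a0 a1 _]]]]]].
    by exists x0; split=> //; rewrite !inE eqxx.
  exact: candidate_mixed ell he1 a0 a1.
case: (elliptic_or_axis r') => [ell'|[c' [l' [f1 [f2 [hf1 hf2 b0 b1 b2]]]]]].
  have [y [? ? ?]] := candidate_mixed ell' he1 a0 a1.
  by exists y.
rewrite -[l]mul1r in a0; rewrite -[l']mul1r in b0.
have one : (1 = 1 :> int \/ 1 = -1 :> int)%R by left.
case: (eqVneq ((1 == e1) : bool)%R (1 == f1)%R) => [h|h].
  by apply: (candidate_pair _ _ one he1 one hf1 h a0 a1 b0 b1); rewrite !inE eqxx ?orbT.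
case: (eqVneq ((1 == e2) : bool)%R (1 == f2)%R) => [h'|h'].
  by apply: (candidate_pair _ _ one he2 one hf2 h' a0 a2 b0 b2); rewrite !inE eqxx ?orbT.
(* The relative sign of [x1] and [x2] is the product of their signs relative to [x0]; if the trees
   disagree on both of these, they agree on the product. *)
have h'' : (e1 == e2)%R = (f1 == f2)%R by lia.
by apply: (candidate_pair _ _ he1 he2 hf1 hf2 h'' a1 a2 b1 b2); rewrite !inE eqxx ?orbT.
Qed.

(** [x0], [x1], [x2] become translations by pairwise independent vectors, so no sum or difference of
    two of them vanishes. *)
Lemma candidate_heis (chi : {multiplicative G -> heis}) (y : G) :
  chi ga = (0, 0, 1)%R -> chi gt = (0, 1, 0)%R ->
  y \in candidates -> exists p q : int, chi y = (p, q, 0)%R /\ (p != 0) || (q != 0).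
Proof.
move=> ca ct.
have e0 : chi x0 = (0, 1, 0)%R by [].
have e1 : chi x1 = (-1, 1, 0)%R by rewrite /x1 !gmulfM mult_inv ca e0.
have e2 : chi x2 = (-2, 1, 0)%R by rewrite /x2 2!gmulfM mult_inv ca e1.
rewrite !inE; clearbody x2; clearbody x1; clearbody x0.
move=> /or4P[/eqP->|/eqP->|/eqP->|/or4P[/eqP->|/eqP->|/eqP->|/eqP->]];
  rewrite ?gmulfM ?mult_inv ?e0 ?e1 ?e2; by eexists; eexists; split; first reflexivity.
Qed.

(** Squares are used because an elliptic [y] may invert an edge, and only [y * y] is sure to fix a
    vertex. *)
Lemma pow_injective (y : G) : y \in candidates -> injective (fun n => (y * y) ^+ n).
Proof.
have [chi [ca _ ct]] := G_heis.
move=> /(candidate_heis ca ct)[p [q [cy pq]]] m n /(congr1 chi).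
rewrite !mult_expn gmulfM cy.
have -> : ((p, q, 0)%R : heis) * ((p, q, 0)%R : heis) = ((p + p, q + q, 0)%R : heis).
  by congr (_, _, _) => /=; lia.
by rewrite !heis_expn => -[]; nia.
Qed.

Lemma not_proper_two_trees (T : 'I_2 -> tree) (rho : {multiplicative G -> prod_aut T}) :
  ~ proper_action rho.
Proof.
move=> prop.
have [y [yc ell0 ell1]] := candidate_exists (component rho ord0) (component rho ord_max).
have ell i : elliptic (rho y i).
  case: i => [[|[|//]] hi].
  - by have -> : Ordinal hi = ord0 by exact: val_inj.
  - by have -> : Ordinal hi = ord_max by exact: val_inj.
(* All powers of [y * y] fix this vertex, so the naturals inject into its stabiliser. *)
pose v : prod_vertex T := fun i => projT1 (cid (ell i)).
have vE i : rho y i (rho y i (v i)) = v i := projT2 (cid (ell i)).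
apply: infinite_nat.
have := @finite_preimage _ _ _ (fun n => (y * y) ^+ n)
  (fun m n _ _ => @pow_injective y yc m n) (prop v).
apply: sub_finite_set => n _ i /=.
elim: n => [|n IH]; first by rewrite expg0 mult_one.
by rewrite expgS gmulfM -[LHS]/(rho (y * y) i (rho ((y * y) ^+ n) i (v i))) IH gmulfM.
Qed.

End NoTwoTrees.

(** * Three trees *)

Section RootedTree.
Local Open Scope nat_scope.
Variables (V : eqType) (e : rel V) (r : V) (depth : V -> nat) (parent : V -> V).
Hypotheses (e_sym : symmetric e) (e_irr : irreflexive e).
(** Passing to parents leads to the root, which gives connectedness; the next hypothesis leaves a
    vertex only one neighbour that is not deeper, which excludes cycles. *)
Hypothesis parent_adj :
  forall x, x = r \/ e x (parent x) /\ depth (parent x) < depth x.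
Hypothesis parent_uniq : forall x y, e x y -> depth y <= depth x -> y = parent x.

Lemma rooted_conn x y : exists2 p, path e x p & y = last x p.
Proof.
have toroot z : exists2 p, path e z p & last z p = r.
  have [n] := ubnP (depth z); elim: n z => // n IH z zn.
  case: (parent_adj z) => [->|[zp dp]]; first by exists [::].
  have [|p hp ep] := IH (parent z); first by apply: leq_trans dp _.
  by exists (parent z :: p); rewrite //= zp.
have [p hp ep] := toroot x; have [q hq eq] := toroot y.
exists (p ++ rev (belast y q)).
  rewrite cat_path hp ep -eq; move: hq; rewrite -rev_path; apply: sub_path => a b /=.
  by rewrite e_sym.
by rewrite last_cat ep -eq; case: (q) => [|u s] //=; rewrite rev_cons last_rcons.
Qed.

(* Both neighbours of a deepest vertex of a cycle are its parent. *)
Lemma rooted_acyclic (c : seq V) : 2 < size c -> ~ ucycle e c.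
Proof.
move=> c2.
have [x xc xmax] : exists2 x, x \in c & forall y, y \in c -> depth y <= depth x.
  elim: c {c2} (ltnW (ltnW c2)) => // x [|y c] IH _.
    by exists x => [|z]; rewrite !inE // => /eqP->.
  have [//|z zc zmax] := IH.
  have [xz|zx] := leqP (depth x) (depth z).
    by exists z => [|w]; rewrite inE ?zc ?orbT // => /predU1P[->//|/zmax].
  exists x => [|w]; rewrite inE ?eqxx // => /predU1P[->//|/zmax wz].
  exact: leq_trans wz (ltnW zx).
case: (rot_to xc) => i s es; rewrite -(rot_ucycle i) es.
have inc y : y \in s -> depth y <= depth x.
  by move=> ys; apply: xmax; rewrite -(mem_rot i) es inE ys orbT.
move: c2; rewrite -(size_rot i) es; case: s inc {es} => [|u s] inc //.
case/lastP: s inc => [|s w] inc // _ /andP[].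
rewrite /= rcons_path last_rcons => /andP[xu /andP[_ wx]].
have eu := parent_uniq xu (inc u (mem_head _ _)).
have ew : w = parent x.
  by apply: parent_uniq; rewrite 1?e_sym // inc // inE mem_rcons mem_head orbT.
by rewrite eu ew mem_rcons mem_head !andbF.
Qed.

Definition rooted_tree : tree :=
  Tree e_sym e_irr (inhabits r) rooted_conn rooted_acyclic.

End RootedTree.

(** * The line and the Bass-Serre tree *)

Definition line_adj (m n : int) : bool := (m == n + 1) || (n == m + 1).
(** The value at the root [0] is a dummy, as both neighbours of [0] are deeper. *)
Definition line_parent (n : int) : int := if 0 < n then n - 1 else n + 1.

Lemma line_adj_sym : symmetric line_adj.
Proof. by move=> m n; rewrite /line_adj orbC. Qed.

Lemma line_adj_irr : irreflexive line_adj.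
Proof. by move=> m; rewrite /line_adj; lia. Qed.

Lemma line_parent_adj n :
  n = 0 \/ line_adj n (line_parent n) /\ (absz (line_parent n) < absz n)%N.
Proof.
case: (eqVneq n 0) => [->|n0]; [by left|right].
by rewrite /line_adj /line_parent; case: ifP => ?; split; lia.
Qed.

Lemma line_parent_uniq m n :
  line_adj m n -> (absz n <= absz m)%N -> n = line_parent m.
Proof. by rewrite /line_adj /line_parent => /orP[]; case: ifP => ?; lia. Qed.

Definition line : tree :=
  rooted_tree line_adj_sym line_adj_irr line_parent_adj line_parent_uniq.

Definition shift (k : int) : tree_aut line.
Proof.
exists (fun n : int => n + k : line) (fun n : int => n - k : line).
- by move=> n; rewrite addrK.
- by move=> n; rewrite subrK.
- by move=> m n; rewrite /= /line_adj; lia.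
Defined.

Definition flip : tree_aut line.
Proof.
exists (fun n : int => - n : line) (fun n : int => - n : line).
- by move=> n; rewrite opprK.
- by move=> n; rewrite opprK.
- by move=> m n; rewrite /= /line_adj; lia.
Defined.

(* The sequence [(n_1, e_1); ...; (n_k, e_k)] stands for the coset
   [b^n_1 a^(+-1) ... b^n_k a^(+-1) <b>] of the free group on [a] and [b],
   where the sign is [+] iff [e_i] holds. *)
Definition bs_step (x y : int * bool) : bool := ~~ ((y.1 == 0) && (y.2 == ~~ x.2)).
(** No letter is followed directly by its inverse, so each coset is represented exactly once. *)
Definition reduced (s : seq (int * bool)) : bool := sorted bs_step s.
(** [G] is the semidirect product of the free group on [a], [b] with [<t>], so these cosets of [<b>]
    are also the cosets of [<b, t>] in [G]. *)
Definition bs_vertex := {s : seq (int * bool) | reduced s}.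

Definition bs_child (s s' : seq (int * bool)) : bool :=
  (s' != [::]) && (take (size s').-1 s' == s).

Lemma bs_childP s s' : reflect (exists x, s' = rcons s x) (bs_child s s').
Proof.
apply: (iffP andP) => [[]|[x ->]].
  case/lastP: s' => // s' x _; rewrite size_rcons /= -cats1 take_size_cat //.
  by move=> /eqP->; exists x; rewrite cats1.
by rewrite size_rcons -cats1 take_size_cat //; case: s.
Qed.

Definition bs_adj (s s' : seq (int * bool)) : bool := bs_child s s' || bs_child s' s.
Definition bs_vadj (v w : bs_vertex) : bool := bs_adj (val v) (val w).

Lemma bs_adj_sym : symmetric bs_adj.
Proof. by move=> s s'; rewrite /bs_adj orbC. Qed.

Lemma bs_vadj_sym : symmetric bs_vadj.
Proof. by move=> v w; apply: bs_adj_sym. Qed.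

Lemma bs_vadj_irr : irreflexive bs_vadj.
Proof.
move=> v; rewrite /bs_vadj /bs_adj orbb; apply/bs_childP => -[x].
by move/(congr1 size); rewrite size_rcons; lia.
Qed.

Definition bs_root : bs_vertex := exist _ [::] isT.
Definition bs_parent (v : bs_vertex) : bs_vertex :=
  exist _ (take (size (val v)).-1 (val v)) (take_sorted _ (valP v)).

Lemma bs_parent_adj v : v = bs_root \/
  bs_vadj v (bs_parent v) /\ (size (val (bs_parent v)) < size (val v))%N.
Proof.
case: v => s hs; case: (eqVneq s [::]) => [s0|s0]; [left|right].
  exact: val_inj.
rewrite /bs_vadj /bs_adj /bs_child /= s0 eqxx orbT size_take.
by case: s s0 {hs} => //= x s _; rewrite !ltnS leqnn.
Qed.

Lemma bs_parent_uniq v w :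
  bs_vadj v w -> (size (val w) <= size (val v))%N -> w = bs_parent v.
Proof.
case/orP => /bs_childP[x e]; first by rewrite e size_rcons ltnn.
move=> _; apply: val_inj; rewrite /= e size_rcons -cats1 take_size_cat //.
Qed.

Definition bs_tree : tree :=
  rooted_tree bs_vadj_sym bs_vadj_irr bs_parent_adj bs_parent_uniq.

(** Since [F'] inverts [F], it is enough that both preserve edges in one direction, and only edges
    from a vertex to a child need checking. *)
Lemma bs_aut (F F' : seq (int * bool) -> seq (int * bool)) :
  (forall s, reduced s -> reduced (F s)) -> (forall s, reduced s -> reduced (F' s)) ->
  (forall s, reduced s -> F' (F s) = s) -> (forall s, reduced s -> F (F' s) = s) ->
  (forall s x, bs_adj (F s) (F (rcons s x))) ->
  (forall s x, bs_adj (F' s) (F' (rcons s x))) ->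
  {f : tree_aut bs_tree | forall v : bs_vertex, val (f v) = F (val v)}.
Proof.
move=> rF rF' FK F'K aF aF'.
pose f (v : bs_vertex) : bs_vertex := exist _ (F (val v)) (rF _ (valP v)).
pose f' (v : bs_vertex) : bs_vertex := exist _ (F' (val v)) (rF' _ (valP v)).
have fK : cancel f f' by move=> v; apply: val_inj; rewrite /= FK // (valP v).
have f'K : cancel f' f by move=> v; apply: val_inj; rewrite /= F'K // (valP v).
have homo (g : seq (int * bool) -> seq (int * bool)) s s' :
    (forall s x, bs_adj (g s) (g (rcons s x))) -> bs_adj s s' -> bs_adj (g s) (g s').
  by move=> ag /orP[] /bs_childP[x ->] //; rewrite bs_adj_sym.
have fa : {mono f : v w / bs_vadj v w}.
  move=> v w; apply/idP/idP => [/(homo F')|]; last exact: homo.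
  by rewrite /= !FK ?(valP v) ?(valP w) //; apply.
by exists (@TreeAut bs_tree f f' fK f'K fa).
Qed.

(* Left multiplication by [b^k]; it fixes the coset <b>, that is [[::]]. *)
Definition bs_b (k : int) (s : seq (int * bool)) : seq (int * bool) :=
  if s is (n, e) :: s' then (n + k, e) :: s' else [::].

(** Left multiplication by [a] if [e] holds and by [a^-1] otherwise, with cancellation against a
    leading inverse letter. *)
Definition bs_a (e : bool) (s : seq (int * bool)) : seq (int * bool) :=
  if s is (n, e') :: s' then
    if (n == 0) && (e' == ~~ e) then s' else (0, e) :: s
  else [:: (0, e)].

(* The [k]-th power of the automorphism [a |-> ab], [b |-> b]; [p] tells
   whether the preceding letter is [a]. *)
Fixpoint bs_t (k : int) (p : bool) (s : seq (int * bool)) : seq (int * bool) :=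
  if s is (n, e) :: s' then
    (n + k * (p%:R - (~~ e)%:R), e) :: bs_t k e s'
  else [::].

Lemma bs_adj_rcons s x : bs_adj s (rcons s x).
Proof. by apply/orP; left; apply/bs_childP; exists x. Qed.

Lemma bs_b_aut k : {f : tree_aut bs_tree | forall v : bs_vertex, val (f v) = bs_b k (val v)}.
Proof.
apply: (@bs_aut (bs_b k) (bs_b (- k))).
- by case=> [|[n e] [|y s]].
- by case=> [|[n e] [|y s]].
- by case=> [|[n e] s] //= _; rewrite addrK.
- by case=> [|[n e] s] //= _; rewrite subrK.
- by case=> [|[n e] s] [m e'] //=; rewrite -rcons_cons bs_adj_rcons.
- by case=> [|[n e] s] [m e'] //=; rewrite -rcons_cons bs_adj_rcons.
Qed.

Lemma bs_a_reduced e s : reduced s -> reduced (bs_a e s).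
Proof.
case: s => [|[n e'] s] //=; case: ifP => [_|h] hs; first exact: path_sorted hs.
by rewrite /reduced /= hs andbT /bs_step /= h.
Qed.

Lemma bs_aK e s : reduced s -> bs_a (~~ e) (bs_a e s) = s.
Proof.
case: s => [|[n e'] s] /=; first by rewrite negbK !eqxx.
case: ifP => [/andP[/eqP-> /eqP->]|h] hs; last by rewrite /= negbK !eqxx.
case: s hs => [|[m f] s] //= /andP[]; rewrite /bs_step /= !negbK.
by move=> /negbTE->.
Qed.

Lemma bs_a_adj e s x : bs_adj (bs_a e s) (bs_a e (rcons s x)).
Proof.
case: s => [|[n e'] s] /=.
  case: x => n e' /=; case: ifP => _.
    by rewrite bs_adj_sym (bs_adj_rcons [::]).
  exact: (bs_adj_rcons [:: _]).
by case: ifP => _; rewrite -?rcons_cons bs_adj_rcons.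
Qed.

Lemma bs_a_aut e : {f : tree_aut bs_tree | forall v : bs_vertex, val (f v) = bs_a e (val v)}.
Proof.
apply: (@bs_aut (bs_a e) (bs_a (~~ e))).
- exact: bs_a_reduced.
- exact: bs_a_reduced.
- exact: bs_aK.
- by move=> s hs; have := bs_aK (~~ e) hs; rewrite negbK.
- exact: bs_a_adj.
- exact: bs_a_adj.
Qed.

(** As [a] goes to [a b^k] and [a^-1] to [b^(-k) a^-1], the power of [b] between a letter and its
    inverse does not change, so no cancellation arises. *)
Lemma bs_t_reduced k p s : reduced s -> reduced (bs_t k p s).
Proof.
case: s => [|x s] //; rewrite /reduced; case: x => n e /=.
elim: s n e (n + _) => [|[m f] s IH] n e n' //= /andP[h /(IH _ _ _)->].
rewrite andbT; move: h; rewrite /bs_step /=.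
by case: e; case: f; rewrite /= ?andbF // subrr mulr0 addr0.
Qed.

Lemma bs_tK k p s : bs_t (- k) p (bs_t k p s) = s.
Proof. by elim: s p => [|[n e] s IH] p //=; rewrite IH mulNr addrK. Qed.

Lemma bs_t_adj k p s x : bs_adj (bs_t k p s) (bs_t k p (rcons s x)).
Proof.
suff [y ->] : exists y, bs_t k p (rcons s x) = rcons (bs_t k p s) y.
  exact: bs_adj_rcons.
elim: s p => [|[n e] s IH] p /=; first by case: x => n e; eexists.
by have [y ->] := IH e; exists y.
Qed.

Lemma bs_t_aut k : {f : tree_aut bs_tree | forall v : bs_vertex, val (f v) = bs_t k false (val v)}.
Proof.
apply: (@bs_aut (bs_t k false) (bs_t (- k) false)).
- exact: bs_t_reduced.
- exact: bs_t_reduced.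
- by move=> s _; apply: bs_tK.
- by move=> s _; rewrite -{1}[k]opprK bs_tK.
- exact: bs_t_adj.
- exact: bs_t_adj.
Qed.

(** A letter [a] put in front sets the flag [p] for the next exponent and so raises it by [1]; on
    the right-hand side [bs_b 1] does this. *)
Lemma bs_rel_ta s : bs_t 1 false (bs_a true s) = bs_a true (bs_b 1 (bs_t 1 false s)).
Proof.
case: s => [|[n e] s] //=; rewrite !mul1r.
have -> : (n + (false%:R - (~~ e)%:R) + 1 == 0) && (e == ~~ true) = (n == 0) && (e == ~~ true).
  by case: e; rewrite ?andbF //= !andbT; lia.
case: ifP => [/andP[_ /eqP->]|_] //=.
rewrite !mul1r; congr (_ :: (_, _) :: _); case: e => /=; lia.
Qed.

Lemma bs_rel_tb s : bs_t 1 false (bs_b 1 s) = bs_b 1 (bs_t 1 false s).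
Proof. by case: s => [|[n e] s] //=; rewrite addrAC. Qed.

Lemma int_affine (phi : int -> int) k :
  (forall n, phi (n + 1) = phi n + k) -> forall n, phi n = phi 0 + n * k.
Proof.
move=> phiS; case=> j; elim: j => [|j IH].
- by rewrite mul0r addr0.
- by rewrite intS addrC phiS IH; lia.
- by have := phiS (Negz 0); rewrite (_ : Negz 0 + 1 = 0) //; lia.
- by have := phiS (Negz j.+1); rewrite (_ : Negz j.+1 + 1 = Negz j) ?IH; lia.
Qed.

Lemma zpow_shift (k n m : int) : zpow (shift k) n m = m + n * k :> int.
Proof.
by apply: (@int_affine (fun n => zpow (shift k) n m)) => q; rewrite zpowS.
Qed.

(** * Vertex stabilisers in the Bass-Serre tree *)

Section CosetRepresentatives.
Local Open Scope group_scope.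

Definition bt_subgroup (g : G) : Prop := exists i j : int, g = zpow gb i * zpow gt j.

Lemma bt_mul g h : bt_subgroup g -> bt_subgroup h -> bt_subgroup (g * h).
Proof.
move=> [i [j ->]] [k [l ->]]; exists (i + k)%R, (j + l)%R; rewrite !zpowD -!mulgA.
by congr (_ * _); rewrite !mulgA; congr (_ * _); exact: commute_zpow commute_tb.
Qed.

Lemma bt_inv g : bt_subgroup g -> bt_subgroup g^-1.
Proof.
move=> [i [j ->]]; exists (- i)%R, (- j)%R; rewrite !zpowN invgM.
by rewrite -!zpowN; exact: commute_zpow commute_tb.
Qed.

Lemma bt_one : bt_subgroup 1.
Proof. by exists 0%R, 0%R; rewrite mul1g. Qed.

Fixpoint coset_rep (s : seq (int * bool)) : G :=
  if s is (n, e) :: s' then zpow gb n * (if e then ga else ga^-1) * coset_rep s' else 1.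

(** This and the next two lemmas show, for each generator, that the action on sequences is left
    multiplication on cosets of [<b, t>]. *)
Lemma coset_rep_b s :
  bt_subgroup ((coset_rep (bs_b 1 s))^-1 * gb * coset_rep s).
Proof.
case: s => [|[n e] s] /=.
  by exists 1%R, 0%R; rewrite invg1 !mulg1 mul1g.
by rewrite zpowS -!(mulgA gb) -[X in bt_subgroup X]mulgA mulVg; exact: bt_one.
Qed.

Lemma coset_rep_a s :
  bt_subgroup ((coset_rep (bs_a true s))^-1 * ga * coset_rep s).
Proof.
suff -> : coset_rep (bs_a true s) = ga * coset_rep s.
  by rewrite -mulgA mulVg; exact: bt_one.
case: s => [|[n e] s] /=; first by rewrite mul1g.
by case: ifP => [/andP[/eqP-> /eqP->]|_] /=; rewrite mul1g // mulVKg.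
Qed.

(** [t] is moved rightwards through the word by [t a = a b t] and [t a^-1 = b^-1 a^-1 t]; the
    element still to be moved is [b t] after a letter [a] and [t] after [a^-1]. *)
Lemma coset_rep_t p s :
  bt_subgroup ((coset_rep (bs_t 1 p s))^-1 * (zpow gb p%:R * gt) * coset_rep s).
Proof.
elim: s p => [|[n e] s IH] p /=.
  by exists p%:R, 1%R; rewrite invg1 mulg1 mul1g.
have tn : gt * zpow gb n = zpow gb n * gt.
  exact: (commute_zpow 1 n commute_tb).
have ta : gt * ga = ga * gb * gt by apply/eqP; rewrite -divg_eq rel_ta.
have taV : gt * ga^-1 = gb^-1 * ga^-1 * gt.
  by apply: (mulgI (ga * gb)); rewrite !mulgA mulgK mulgV mul1g -ta mulgK.
rewrite -[X in bt_subgroup X]mulgA.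
have -> : zpow gb p%:R * gt * (zpow gb n * (if e then ga else ga^-1) * coset_rep s) =
    zpow gb (n + 1 * (p%:R - (~~ e)%:R))%R * (if e then ga else ga^-1) *
    (zpow gb e%:R * gt * coset_rep s).
  rewrite mul1r addrA (addrC n) !zpowD -!mulgA; congr (_ * _).
  rewrite (mulgA gt) tn -!mulgA; congr (_ * _).
  by case: e; rewrite /= ?mul1g mulgA ?ta ?taV !mulgA.
by rewrite invgM -[X in bt_subgroup X]mulgA mulKg mulgA; apply: IH.
Qed.

(** The claim for a product follows from the claims for its factors, so generators suffice. If [g]
    fixes [v], it puts [g] in a conjugate of [<b, t>]. *)
Lemma coset_rep_act (r : {multiplicative G -> tree_aut bs_tree}) :
  (forall v : bs_vertex, val (r ga v : bs_vertex) = bs_a true (val v)) ->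
  (forall v : bs_vertex, val (r gb v : bs_vertex) = bs_b 1 (val v)) ->
  (forall v : bs_vertex, val (r gt v : bs_vertex) = bs_t 1 false (val v)) ->
  forall g (v : bs_vertex), bt_subgroup
    ((coset_rep (val (r g v : bs_vertex)))^-1 * g * coset_rep (val v)).
Proof.
move=> ra rb rt.
have gen c : c \in [:: ga; gb; gt] -> forall v : bs_vertex, bt_subgroup
    ((coset_rep (val (r c v : bs_vertex)))^-1 * c * coset_rep (val v)).
  rewrite !inE => /or3P[] /eqP-> v; rewrite ?ra ?rb ?rt.
  - exact: coset_rep_a.
  - exact: coset_rep_b.
  - by have := coset_rep_t false (val v); rewrite mul1g.
elim/G_ind => [v|c g hc IH v|c g hc IH v].
- by rewrite mult_one /= mulg1 mulVg; exact: bt_one.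
- have := bt_mul (gen c hc (r g v)) (IH v).
  by rewrite -!mulgA mulVKg gmulfM.
(* For an inverse generator, the claim for [c] is used at the vertex that [c] sends to [r g v], and
   inverted. *)
- have := bt_mul (bt_inv (gen c hc (r (c^-1 * g) v))) (IH v).
  have -> : r c (r (c^-1 * g) v) = r g v.
    by rewrite -{2}[g](mulVKg c) gmulfM.
  by rewrite !invgM invgK -!mulgA mulVKg.
Qed.

End CosetRepresentatives.

(** * The action on three trees *)

Section ThreeTrees.
Local Open Scope group_scope.

Let A := projT1 (bs_a_aut true).
Let B := projT1 (bs_b_aut 1%R).
Let C := projT1 (bs_t_aut 1%R).

Let three (i : nat) : tree := if i is 0 then bs_tree else line.
Let T (i : 'I_3) : tree := three i.

Let tuple_aut (f : tree_aut bs_tree) (g h : tree_aut line) : prod_aut T :=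
  fun i => match nat_of_ord i as n return tree_aut (three n) with
           | 0 => f | 1 => g | _ => h end.

Lemma tuple_autM f g h f' g' h' :
  tuple_aut f g h * tuple_aut f' g' h' = tuple_aut (f * f') (g * g') (h * h').
Proof. by apply: functional_extensionality_dep => -[[|[|]]]. Qed.

Lemma proper_three_trees :
  exists (T : 'I_3 -> tree) (rho : {multiplicative G -> prod_aut T}), proper_action rho.
Proof.
(* On the third tree, conjugating the reflection [a] by the unit translation [t] must give [a b],
   which forces [b] to translate by [-2]. *)
pose a := tuple_aut A (shift 0) flip; pose b := tuple_aut B (shift 0) (shift (-2)).
pose t := tuple_aut C (shift 1) (shift 1).
have [||rho [ra rb rt]] := @G_hom (prod_aut T) a b t.
- apply/eqP; rewrite divg_eq !tuple_autM; apply/eqP; congr tuple_aut.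
  + apply: tree_aut_ext => v; apply: val_inj => /=.
    rewrite (projT2 (bs_t_aut 1%R)) !(projT2 (bs_a_aut true)) (projT2 (bs_b_aut 1%R)).
    by rewrite (projT2 (bs_t_aut 1%R)) bs_rel_ta.
  + by apply: tree_aut_ext => v /=; lia.
  + by apply: tree_aut_ext => v /=; lia.
- apply/eqP; rewrite divg_eq !tuple_autM; apply/eqP; congr tuple_aut.
  + apply: tree_aut_ext => v; apply: val_inj => /=.
    rewrite (projT2 (bs_t_aut 1%R)) !(projT2 (bs_b_aut 1%R)).
    by rewrite (projT2 (bs_t_aut 1%R)) bs_rel_tb.
  + by apply: tree_aut_ext => v /=; lia.
  + by apply: tree_aut_ext => v /=; lia.
exists T, rho => v; apply: (@sub_finite_set _ _ [set 1]); last exact: finite_set1.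
move=> g fix_g.
pose r i : {multiplicative G -> tree_aut (T i)} := component rho i.
pose i0 : 'I_3 := Ordinal (isT : 0 < 3)%N.
pose i1 : 'I_3 := Ordinal (isT : 1 < 3)%N.
pose i2 : 'I_3 := Ordinal (isT : 2 < 3)%N.
pose w := coset_rep (val (v i0 : bs_vertex)).
have [k [l gE]] : bt_subgroup (w^-1 * g * w).
  have := @coset_rep_act (r i0) _ _ _ g (v i0); rewrite [r i0 g (v i0)]fix_g; apply.
  - by move=> s; rewrite -(projT2 (bs_a_aut true)) /r /= /component ra.
  - by move=> s; rewrite -(projT2 (bs_b_aut 1%R)) /r /= /component rb.
  - by move=> s; rewrite -(projT2 (bs_t_aut 1%R)) /r /= /component rt.
(* Conjugating by [w] turns [g] into [b^k t^l] and the fixed vertex into its translate by [w^-1];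
   the two lines then give [l = 0] and [l - 2 k = 0]. *)
have fixw i : r i (zpow gb k * zpow gt l) (r i w^-1 (v i)) = r i w^-1 (v i).
  rewrite -gE -[LHS]/((r i (w^-1 * g * w) * r i w^-1) (v i)) -gmulfM mulgK gmulfM.
  by congr (r i w^-1 _); exact: fix_g.
have r1b : r i1 gb = shift 0 by rewrite /r /component /= /component rb.
have r1t : r i1 gt = shift 1 by rewrite /r /component /= /component rt.
have r2b : r i2 gb = shift (-2) by rewrite /r /component /= /component rb.
have r2t : r i2 gt = shift 1 by rewrite /r /component /= /component rt.
have l0 : l = 0%R.
  have := fixw i1; rewrite gmulfM !mult_zpow r1b r1t; set m := r i1 _ _.
  rewrite -[LHS]/(zpow (shift 0) k (zpow (shift 1) l m)) !zpow_shift; lia.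
have k0 : k = 0%R.
  have := fixw i2; rewrite gmulfM !mult_zpow r2b r2t; set m := r i2 _ _.
  rewrite -[LHS]/(zpow (shift (-2)) k (zpow (shift 1) l m)) !zpow_shift; lia.
move: gE; rewrite k0 l0 mulg1 => gE.
by apply: (mulIg w); apply: (mulgI w^-1); rewrite mulgA gE mul1g mulVg.
Qed.

End ThreeTrees.

Theorem proposition6p3 :
  (exists (T : 'I_3 -> tree) (rho : {multiplicative G -> prod_aut T}),
     proper_action rho) /\
  ~ (exists (T : 'I_2 -> tree) (rho : {multiplicative G -> prod_aut T}),
       proper_action rho).
Proof.
split; first exact: proper_three_trees.
by move=> [T [rho]]; exact: not_proper_two_trees.
Qed.
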